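(* The type $B_n$ zigzag algebra $\mathscr{B}_n$ ($n\ge2$) categorifies the type $B_n$ Cartan matrix, in the following sense. Let $N(t)$ be the $n\times n$ matrix whose $(k,j)$ entry is the graded dimension $\mathrm{g_rdim}_{\mathbb{F}_j}({}_jP_k)$ of ${}_jP_k=e_j\mathscr{B}_ne_k$ as a left $\mathbb{F}_j$-vector space, with respect to the path-length grading (with variable $t$), where $\mathbb{F}_1=\mathbb{R}$ and $\mathbb{F}_j=\mathbb{C}$ for $j\ge2$. Then $N(-1)$ is the type $B_n$ Cartan matrix $$\begin{pmatrix}2&-1&0&\cdots&0\\-2&2&-1&\ddots&\vdots\\0&-1&2&\ddots&0\\\vdots&\ddots&\ddots&\ddots&-1\\0&\cdots&0&-1&2\end{pmatrix}.$$
   Context: $\mathscr{B}_n$: let $Q_n$ be the quiver with vertices $1,\dots,n$, arrows $(j|j+1):j\to j+1$, $(j+1|j):j+1\to j$ ($1\le j\le n-1$) and loops $ie_j$ at $j$ ($2\le j\le n$). Paths are concatenated left to right and $e_j$ is the constant path. $\mathscr{B}_n$ is the quotient of $\mathbb{R}Q_n$ by: $(j|j-1)(j-1|j)=(j|j+1)(j+1|j)$, $(j-1|j)(j|j+1)=0=(j+1|j)(j|j-1)$ for $2\le j\le n-1$; $(ie_j)^2=-e_j$ ($j\ge2$); $(ie_{j-1})(j-1|j)=(j-1|j)(ie_j)$, $(ie_j)(j|j-1)=(j|j-1)(ie_{j-1})$ ($j\ge3$); $(1|2)(ie_2)(2|1)=0$; $(ie_2)X_2=X_2(ie_2)$ with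 $X_2=(2|1)(1|2)$. Path-length grading: every arrow $(j|j\pm1)$ has degree 1, and all $e_j$, $ie_j$ have degree 0. ${}_jP_k={}_jP\otimes_{\mathscr{B}_n}P_k\cong e_j\mathscr{B}_ne_k$ with $P_k=\mathscr{B}_ne_k$, ${}_jP=e_j\mathscr{B}_n$. For $j\ge2$ it is a left $\mathbb{C}$-vector space with $i$ acting by left multiplication by $ie_j$. The graded dimension of $V=\bigoplus_kV_k$ is $\sum_k\dim(V_k)t^k$. *)

(* Defs.v *)
From HB Require Import structures.
From mathcomp Require Import all_boot all_order all_algebra.
From mathcomp Require Import finmap monalg complex boolp reals.

Set Implicit Arguments.
Unset Strict Implicit.
Unset Printing Implicit Defensive.

Import Order.TTheory GRing.Theory Num.Theory.
Local Open Scope ring_scope.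
Local Open Scope quotient_scope.

(* Conventions.  The vertices 1, ..., n of Q_n are the ordinals 0, ..., n-1,
   so "vertex j >= 2" reads (0 < j)%N. *)

(* Q_n has at most one arrow between an ordered pair of vertices, so an arrow
   is the same thing as a pair (x, y) with qarrow x y: it is (x|x+1), (x+1|x)
   or, when x = y, the loop i e_x.  A path is then a walk x -> s_0 -> s_1 ...,
   with (x, [::]) the constant path e_x. *)
Definition qarrow n (x y : 'I_n) : bool :=
  [|| y == x.+1 :> nat, x == y.+1 :> nat | (x == y) && (0 < x)%N].

Record qpath n := QPath {
  qwalk : 'I_n * seq 'I_n;
  _ : path (@qarrow n) qwalk.1 qwalk.2 }.

HB.instance Definition _ n := [isSub for @qwalk n].
HB.instance Definition _ n := [Choice of qpath n by <:].

Definition qsource n (p : qpath n) : 'I_n := (qwalk p).1.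
Definition qtarget n (p : qpath n) : 'I_n := last (qwalk p).1 (qwalk p).2.

(* The path-length degree: the loops i e_j do not count. *)
Definition qdeg n (p : qpath n) : nat :=
  let: (x, s) := qwalk p in count (fun a => a.1 != a.2) (zip (x :: s) s).

Definition pathalg (R : realType) n : Type := {malg R[qpath n]}.
HB.instance Definition _ (R : realType) n :=
  GRing.Lmodule.copy (pathalg R n) {malg R[qpath n]}.

(* The locks here and below only keep conversion from unfolding finitely
   supported functions. *)
HB.lock Definition vec (R : realType) n (p : qpath n) : pathalg R n := << p >>.
Canonical vec_unlockable := Unlockable vec.unlock.

HB.lock Definition lin (R : realType) n (V : lmodType R) (h : qpath n -> V)
  (f : pathalg R n) : V := \sum_(p <- msupp f) f@_p *: h p.
Canonical lin_unlockable := Unlockable lin.unlock.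

Section PathAlgebra.
Variables (R : realType) (n : nat).
Local Notation A := (pathalg R n).

(* 0 when the given vertices do not form a path of Q_n *)
Definition walk (x : 'I_n) (s : seq 'I_n) : A :=
  if insub (x, s) is Some p then vec R p else 0.

Definition pcat (p q : qpath n) : A :=
  if qtarget p == qsource q
  then walk (qsource p) ((qwalk p).2 ++ (qwalk q).2) else 0.

Fact pmul_key : unit. Proof. by []. Qed.
Definition pmul : A -> A -> A := locked_with pmul_key (fun f g =>
  \sum_(p <- msupp f) \sum_(q <- msupp g) (f@_p * g@_q) *: pcat p q).
Canonical pmul_unlockable := [unlockable fun pmul].

Definition pone : A := \sum_(x < n) walk x [::].

Lemma linEw (V : lmodType R) (h : qpath n -> V) (f : A) (D : {fset qpath n}) :
  (msupp f `<=` D)%fset -> lin h f = \sum_(p <- D) f@_p *: h p.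
Proof.
move=> sD; rewrite unlock; apply: (big_fset_incl _ sD) => p _ pf.
by rewrite mcoeff_outdom // scale0r.
Qed.

Lemma lin_is_linear (V : lmodType R) (h : qpath n -> V) (c : R) (f g : A) :
  lin h (c *: f + g) = c *: lin h f + lin h g.
Proof.
pose D := (msupp f `|` msupp g)%fset.
have sf : (msupp f `<=` D)%fset by rewrite fsubsetUl.
have sg : (msupp g `<=` D)%fset by rewrite fsubsetUr.
rewrite (linEw h sf) (linEw h sg) scaler_sumr -big_split /=.
have sfg : (msupp (c *: f + g) `<=` D)%fset.
  apply: fsubset_trans (msuppD_le _ _) _; apply: fsetUSS => //.
  exact: msuppZ_le.
rewrite (linEw h sfg); apply: eq_bigr => p _.
by rewrite mcoeffD mcoeffZ scalerDl scalerA.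
Qed.

HB.instance Definition _ (V : lmodType R) (h : qpath n -> V) :=
  GRing.isLinear.Build R A V *:%R (lin h) (lin_is_linear h).

Lemma linU (V : lmodType R) (h : qpath n -> V) p : lin h (vec R p) = h p.
Proof.
rewrite [vec]unlock (linEw h (D := [fset p]%fset)) ?msuppU_le // big_seq_fset1.
by rewrite mcoeffUU scale1r.
Qed.

Lemma malgUZ c p : (<< c *g p >> : A) = c *: vec R p.
Proof.
by rewrite [vec]unlock; apply/malgP=> q; rewrite mcoeffZ [LHS]mcoeffU [X in c * X]mcoeffU mulrnAr mulr1.
Qed.

Lemma lin_id (f : A) : lin (fun p => vec R p : A) f = f.
Proof. by rewrite [lin]unlock [RHS]monalgE; apply: eq_bigr => p _; rewrite malgUZ. Qed.

Lemma eq_lin (V : lmodType R) (h h' : qpath n -> V) : h =1 h' -> lin h =1 lin h'.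
Proof. by move=> e f; rewrite [lin]unlock; apply: eq_bigr => p _; rewrite e. Qed.

Lemma lin_lin (V W : lmodType R) (h : qpath n -> V) (k : {linear V -> W}) f :
  k (lin h f) = lin (fun p => k (h p)) f.
Proof.
by rewrite [lin]unlock linear_sum; apply: eq_bigr => p _; rewrite linearZ.
Qed.

Lemma lin_scale (V : lmodType R) (h : qpath n -> V) c f :
  c *: lin h f = lin (fun p => c *: h p) f.
Proof.
rewrite [lin]unlock scaler_sumr; apply: eq_bigr => p _.
by rewrite !scalerA mulrC.
Qed.

Lemma lin_add (V : lmodType R) (h k : qpath n -> V) f :
  lin (fun p => h p + k p) f = lin h f + lin k f.
Proof.
by rewrite [lin]unlock -big_split; apply: eq_bigr => p _; rewrite scalerDr.
Qed.

Lemma pmulE f g : pmul f g = lin (fun p => lin (pcat p) g) f.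
Proof.
rewrite [pmul]unlock [lin]unlock; apply: eq_bigr => p _; rewrite scaler_sumr.
by apply: eq_bigr => q _; rewrite scalerA.
Qed.

Lemma pmul_linl g c : {morph pmul^~ g : f f' / c *: f + f'}.
Proof. by move=> f f'; rewrite !pmulE linearP. Qed.

Lemma pmul_linr f c : {morph pmul f : g g' / c *: g + g'}.
Proof.
move=> g g'; rewrite !pmulE [in RHS]lin_scale -lin_add; apply: eq_lin => p.
by rewrite linearP.
Qed.

HB.instance Definition _ f := GRing.isLinear.Build R A A *:%R (pmul f)
  (fun c => pmul_linr f c).
Definition pmulr g f := pmul f g.
HB.instance Definition _ g := GRing.isLinear.Build R A A *:%R (pmulr g)
  (fun c => pmul_linl g c).

Lemma pmulUU p q : pmul (vec R p) (vec R q) = pcat p q.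
Proof. by rewrite pmulE !linU. Qed.

Lemma walkE (p : qpath n) : walk (qwalk p).1 (qwalk p).2 = vec R p.
Proof.
rewrite /walk -surjective_pairing.
by rewrite (_ : insub _ = Some p) // -[RHS](valK p).
Qed.

Lemma walk_path x s (h : path (@qarrow n) (x, s).1 (x, s).2) :
  walk x s = vec R (QPath h).
Proof. by rewrite -walkE. Qed.

Lemma path_cat (p q : qpath n) : qtarget p = qsource q ->
  path (@qarrow n) (qsource p, (qwalk p).2 ++ (qwalk q).2).1
                   (qsource p, (qwalk p).2 ++ (qwalk q).2).2.
Proof.
case: p q => [[x s] /= hs] [[y t] /= ht].
by rewrite /qtarget /qsource /= cat_path hs /= => ->.
Qed.

Lemma pcatE p q (e : qtarget p = qsource q) : pcat p q = vec R (QPath (path_cat e)).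
Proof. by rewrite /pcat e eqxx -walk_path. Qed.

Lemma pcat0 p q : qtarget p != qsource q -> pcat p q = 0.
Proof. by rewrite /pcat => /negbTE ->. Qed.

Lemma pmul0 g : pmul 0 g = 0.
Proof. by rewrite -[LHS]/(pmulr g 0) linear0. Qed.

Lemma pmulr0 f : pmul f 0 = 0.
Proof. exact: linear0. Qed.

Lemma qtarget_cat p q (e : qtarget p = qsource q) :
  qtarget (QPath (path_cat e)) = qtarget q.
Proof. by rewrite [LHS]/qtarget /= last_cat [last (qsource p) _]e. Qed.

Lemma pcatA p q r : pmul (vec R p) (pcat q r) = pmul (pcat p q) (vec R r).
Proof.
have [epq|npq] := eqVneq (qtarget p) (qsource q); last first.
  rewrite (pcat0 npq) pmul0.
  have [eqr|nqr] := eqVneq (qtarget q) (qsource r); last first.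
    by rewrite (pcat0 nqr) pmulr0.
  by rewrite (pcatE eqr) pmulUU pcat0.
rewrite (pcatE epq).
have [eqr|nqr] := eqVneq (qtarget q) (qsource r); last first.
  by rewrite (pcat0 nqr) pmulr0 pmulUU pcat0 // qtarget_cat.
rewrite (pcatE eqr) !pmulUU /pcat qtarget_cat eqr eqxx.
by rewrite [qsource (QPath _)]/qsource /= epq eqxx catA.
Qed.

Lemma pmul_lin (h : qpath n -> A) f g : pmul (lin h f) g = lin (fun p => pmul (h p) g) f.
Proof. exact: (@lin_lin A A h (pmulr g)). Qed.

Lemma pmulr_lin (h : qpath n -> A) f g : pmul f (lin h g) = lin (fun q => pmul f (h q)) g.
Proof. exact: (@lin_lin A A h (pmul f)). Qed.

Lemma pmulA : associative pmul.
Proof.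
move=> f g h.
rewrite -[f]lin_id !pmul_lin; apply: eq_lin => p.
rewrite -[g]lin_id pmul_lin !pmulr_lin pmul_lin; apply: eq_lin => q.
rewrite -[h]lin_id !pmulr_lin; apply: eq_lin => r.
by rewrite !pmulUU pcatA.
Qed.

Lemma pmul_e x (p : qpath n) :
  pmul (walk x [::]) (vec R p) = if x == qsource p then vec R p else 0.
Proof.
rewrite (@walk_path x [::] isT) pmulUU /pcat [qtarget _](_ : _ = x) //.
by case: eqP => // ->; rewrite -walkE.
Qed.

Lemma pmulr_e x (p : qpath n) :
  pmul (vec R p) (walk x [::]) = if x == qtarget p then vec R p else 0.
Proof.
rewrite (@walk_path x [::] isT) pmulUU /pcat [qsource (QPath _)](_ : _ = x) //.
by rewrite eq_sym; case: eqP => // _; rewrite /= cats0 -walkE.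
Qed.

Lemma pmul1 : left_id pone pmul.
Proof.
move=> f; rewrite -[f]lin_id pmulr_lin; apply: eq_lin => p.
rewrite -[LHS]/(pmulr _ _) linear_sum (bigD1 (qsource p)) //= {1}/pmulr pmul_e.
by rewrite eqxx big1 ?addr0 // => x nx; rewrite /pmulr pmul_e (negbTE nx).
Qed.

Lemma pmulr1 : right_id pone pmul.
Proof.
move=> f; rewrite -[f]lin_id pmul_lin; apply: eq_lin => p.
rewrite linear_sum (bigD1 (qtarget p)) //= pmulr_e.
by rewrite eqxx big1 ?addr0 // => x nx; rewrite pmulr_e (negbTE nx).
Qed.

Lemma pmulDl : left_distributive pmul +%R.
Proof. by move=> f g h; rewrite -!/(pmulr _ _) linearD. Qed.

Lemma pmulDr : right_distributive pmul +%R.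
Proof. by move=> f g h; rewrite linearD. Qed.

HB.instance Definition _ := GRing.Zmodule_isPzRing.Build A
  pmulA pmul1 pmulr1 pmulDl pmulDr.

Lemma pathalg_scaleAl (c : R) (f g : A) : c *: (f * g) = (c *: f) * g.
Proof. by rewrite -[f * g]/(pmulr g f) -linearZ. Qed.

Lemma pathalg_scaleAr (c : R) (f g : A) : c *: (f * g) = f * (c *: g).
Proof. by rewrite -[f * g]/(pmul f g) -linearZ. Qed.

Lemma walk_e x s : walk x [::] * walk x s = walk x s.
Proof.
rewrite -[LHS]/(pmul _ _) {2 3}/walk; case: insubP => [p _ ep|_].
  by rewrite pmul_e /qsource ep eqxx.
by rewrite pmulr0.
Qed.

(* Used below for arrows only: arr j k is (j|k) when j and k are adjacent,
   and loop j is i e_j for j >= 2. *)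
Definition arr (j k : 'I_n) : A := walk j [:: k].
Definition loop (j : 'I_n) : A := walk j [:: j].

Inductive zigzag_rel : A -> Prop :=
| rel_zigzag (i j k : 'I_n) of j = i.+1 :> nat & k = j.+1 :> nat :
    zigzag_rel (arr j i * arr i j - arr j k * arr k j)
| rel_up (i j k : 'I_n) of j = i.+1 :> nat & k = j.+1 :> nat :
    zigzag_rel (arr i j * arr j k)
| rel_down (i j k : 'I_n) of j = i.+1 :> nat & k = j.+1 :> nat :
    zigzag_rel (arr k j * arr j i)
| rel_sq (j : 'I_n) of (0 < j)%N :
    zigzag_rel (loop j * loop j + walk j [::])
| rel_loop_up (i j : 'I_n) of (0 < i)%N & j = i.+1 :> nat :
    zigzag_rel (loop i * arr i j - arr i j * loop j)
| rel_loop_down (i j : 'I_n) of (0 < i)%N & j = i.+1 :> nat :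
    zigzag_rel (loop j * arr j i - arr j i * loop i)
| rel_one (i j : 'I_n) of i = 0%N :> nat & j = 1%N :> nat :
    zigzag_rel (arr i j * loop j * arr j i)
| rel_two (i j : 'I_n) of i = 0%N :> nat & j = 1%N :> nat :
    zigzag_rel (loop j * (arr j i * arr i j) - (arr j i * arr i j) * loop j).

End PathAlgebra.

Section Ideals.
Variable A : pzRingType.

Definition two_sided_ideal (I : A -> Prop) : Prop :=
  [/\ I 0, forall x y, I x -> I y -> I (x - y)
    & forall a x b, I x -> I (a * x * b)].

Definition ideal_of (S : A -> Prop) : {pred A} := fun x =>
  `[< forall I, two_sided_ideal I -> (forall y, S y -> I y) -> I x >].

Lemma ideal_of_zmod S : zmod_closed (ideal_of S).
Proof.
split; first by apply/asboolP => I [].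
move=> x y /asboolP hx /asboolP hy; apply/asboolP => I hI hS.
by case: (hI) => _ + _; apply; [exact: hx|exact: hy].
Qed.
HB.instance Definition _ S := GRing.isZmodClosed.Build A (ideal_of S)
  (ideal_of_zmod S).

Lemma ideal_ofM S a x b : x \in ideal_of S -> a * x * b \in ideal_of S.
Proof.
by move=> /asboolP hx; apply/asboolP=> I hI hS; case: (hI) => _ _; apply; apply: hx.
Qed.

Lemma ideal_ofMl S a x : x \in ideal_of S -> a * x \in ideal_of S.
Proof. by move=> h; rewrite -[a * x]mulr1; apply: ideal_ofM. Qed.

Lemma ideal_ofMr S x b : x \in ideal_of S -> x * b \in ideal_of S.
Proof. by move=> h; rewrite -[x]mul1r; apply: ideal_ofM. Qed.

End Ideals.

Section Zigzag.
Variables (R : realType) (n : nat).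
Local Notation A := (pathalg R n).

Definition zigzag : Type := Quotient.quot (ideal_of (@zigzag_rel R n)).
HB.instance Definition _ :=
  ZmodQuotient.on zigzag.

Implicit Types (x y : zigzag) (f g h : A).

Definition zone : zigzag := lift_cst zigzag 1.
Definition zmul : zigzag -> zigzag -> zigzag := lift_op2 zigzag *%R.
Definition zscale (c : R) : zigzag -> zigzag := lift_op1 zigzag ( *:%R c).

Lemma pi_eq f g :
  (\pi_zigzag f = \pi_zigzag g) <-> f - g \in ideal_of (@zigzag_rel R n).
Proof.
rewrite [_ \in _](Quotient.idealrBE (ideal_of (@zigzag_rel R n))).
by split=> /eqP.
Qed.

Lemma repr_pi f : repr (\pi_zigzag f) - f \in ideal_of (@zigzag_rel R n).
Proof. by apply/pi_eq; rewrite reprK. Qed.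

Lemma pi_zmul f g : \pi_zigzag (f * g) = zmul (\pi_zigzag f) (\pi_zigzag g).
Proof.
unlock zmul; apply/esym/pi_eq; set f' := repr _; set g' := repr _.
have -> : f' * g' - f * g = (f' - f) * g' + f * (g' - g).
  by rewrite mulrBl mulrBr addrA subrK.
apply: rpredD; [exact: ideal_ofMr (repr_pi f)|exact: ideal_ofMl (repr_pi g)].
Qed.

Lemma pi_zscale c f : \pi_zigzag (c *: f) = zscale c (\pi_zigzag f).
Proof.
unlock zscale; apply/esym/pi_eq; rewrite -scalerBr -[X in c *: X]mul1r pathalg_scaleAl.
exact: ideal_ofMl (repr_pi f).
Qed.

Lemma zigzag_ind (P : zigzag -> Prop) : (forall f, P (\pi_zigzag f)) -> forall x, P x.
Proof. by move=> h x; rewrite -[x]reprK. Qed.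

Lemma pi_zD f g : \pi_zigzag (f + g) = \pi_zigzag f + \pi_zigzag g.
Proof. exact: raddfD. Qed.

Lemma zmulA : associative zmul.
Proof.
elim/zigzag_ind=> f; elim/zigzag_ind=> g; elim/zigzag_ind=> h.
by rewrite -!pi_zmul mulrA.
Qed.
Lemma zmul1 : left_id zone zmul.
Proof. by elim/zigzag_ind=> f; unlock zone; rewrite -pi_zmul mul1r. Qed.
Lemma zmulr1 : right_id zone zmul.
Proof. by elim/zigzag_ind=> f; unlock zone; rewrite -pi_zmul mulr1. Qed.
Lemma zmulDl : left_distributive zmul +%R.
Proof.
elim/zigzag_ind=> f; elim/zigzag_ind=> g; elim/zigzag_ind=> h.
by rewrite -pi_zD -!pi_zmul mulrDl pi_zD.
Qed.
Lemma zmulDr : right_distributive zmul +%R.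
Proof.
elim/zigzag_ind=> f; elim/zigzag_ind=> g; elim/zigzag_ind=> h.
by rewrite -pi_zD -!pi_zmul mulrDr pi_zD.
Qed.
HB.instance Definition _ := GRing.Zmodule_isPzRing.Build zigzag
  zmulA zmul1 zmulr1 zmulDl zmulDr.

Lemma zscaleA a b x : zscale a (zscale b x) = zscale (a * b) x.
Proof. by elim/zigzag_ind: x => f; rewrite -!pi_zscale scalerA. Qed.
Lemma zscale1 : left_id 1 zscale.
Proof. by elim/zigzag_ind=> f; rewrite -pi_zscale scale1r. Qed.
Lemma zscaleDr : right_distributive zscale +%R.
Proof.
move=> c; elim/zigzag_ind=> f; elim/zigzag_ind=> g.
by rewrite -pi_zD -!pi_zscale scalerDr pi_zD.
Qed.
Lemma zscaleDl x : {morph zscale^~ x : a b / a + b}.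
Proof. by elim/zigzag_ind: x=> f a b; rewrite -!pi_zscale scalerDl pi_zD. Qed.
HB.instance Definition _ := GRing.Zmodule_isLmodule.Build R zigzag
  zscaleA zscale1 zscaleDr zscaleDl.

Lemma pi_M f g : \pi_zigzag (f * g) = \pi_zigzag f * \pi_zigzag g.
Proof. exact: pi_zmul. Qed.
Lemma pi_Z c f : \pi_zigzag (c *: f) = c *: \pi_zigzag f.
Proof. exact: pi_zscale. Qed.

Lemma zigzag_scaleAl (c : R) x y : c *: (x * y) = (c *: x) * y.
Proof.
elim/zigzag_ind: x y => f; elim/zigzag_ind => g.
by rewrite -pi_M -!pi_Z -pi_M pathalg_scaleAl.
Qed.
Lemma zigzag_scaleAr (c : R) x y : c *: (x * y) = x * (c *: y).
Proof.
elim/zigzag_ind: x y => f; elim/zigzag_ind => g.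
by rewrite -pi_M -!pi_Z -pi_M pathalg_scaleAr.
Qed.

Definition e_ (j : 'I_n) : zigzag := \pi_zigzag (walk R j [::]).
Definition ie_ (j : 'I_n) : zigzag := \pi_zigzag (loop R j).

Lemma ie_sq (j : 'I_n) : (0 < j)%N -> ie_ j * ie_ j = - e_ j.
Proof.
move=> j0; apply/eqP; rewrite -addr_eq0 /ie_ /e_ -pi_M -pi_zD; apply/eqP.
rewrite -[RHS](raddf0 \pi_zigzag); apply/pi_eq; rewrite subr0.
by apply/asboolP => I hI; apply; exact: rel_sq.
Qed.

Lemma e_ie j : e_ j * ie_ j = ie_ j.
Proof. by rewrite -pi_M walk_e. Qed.

Lemma e_idem j : e_ j * e_ j = e_ j.
Proof. by rewrite -pi_M walk_e. Qed.

(* e_j B = {x | e_j x = x}, as e_j is idempotent *)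
Definition in_eB j : {pred zigzag} := fun x => e_ j * x == x.

Lemma in_eB_zmod j : zmod_closed (in_eB j).
Proof.
split; first by rewrite unfold_in mulr0.
by move=> x y /eqP hx /eqP hy; rewrite unfold_in mulrBr hx hy.
Qed.
HB.instance Definition _ j := GRing.isZmodClosed.Build zigzag (in_eB j)
  (in_eB_zmod j).

(* The condition j >= 2 is a parameter of the type because the complex
   structure below only exists in that case. *)
Record eB (j : 'I_n) (j_gt0 : (0 < j)%N) := EB { eB_val : zigzag; _ : in_eB j eB_val }.
HB.instance Definition _ (j : 'I_n) (j0 : (0 < j)%N) := [isSub for @eB_val j j0].
HB.instance Definition _ (j : 'I_n) (j0 : (0 < j)%N) := [Choice of eB j0 by <:].
HB.instance Definition _ (j : 'I_n) (j0 : (0 < j)%N) :=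
  [SubChoice_isSubZmodule of eB j0 by <:].

Section Complex.
Variables (j : 'I_n) (j0 : (0 < j)%N).
Implicit Types u v : eB j0.

Definition cact (z : R[i]) (x : zigzag) : zigzag :=
  complex.Re z *: x + complex.Im z *: (ie_ j * x).

Lemma cact_in z u : in_eB j (cact z (eB_val u)).
Proof.
case: u => x /= /eqP hx; apply/eqP.
by rewrite mulrDr -!zigzag_scaleAr hx mulrA e_ie.
Qed.

Definition eB_scale z u : eB j0 := EB j0 (cact_in z u).

Lemma eB_scaleA a b u : eB_scale a (eB_scale b u) = eB_scale (a * b) u.
Proof.
apply: val_inj; case: u a b => x /= /eqP hx [a1 a2] [b1 b2].
rewrite /cact /= mulrDr !scalerDr -!zigzag_scaleAr !scalerA mulrA.
rewrite ie_sq // mulNr hx !scalerN scalerBl scalerDl.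
move: (_ *: x) (_ *: x) (_ *: (_ * x)) (_ *: (_ * x)) => p q r s.
by rewrite [r - _]addrC addrACA.
Qed.

Lemma eB_scale1 : left_id 1 eB_scale.
Proof.
by move=> u; apply: val_inj; rewrite /= /cact /= scale1r scale0r addr0.
Qed.

Lemma eB_scaleDr : right_distributive eB_scale +%R.
Proof.
move=> z u v; apply: val_inj; rewrite /= /cact /=.
by rewrite mulrDr !scalerDr addrACA.
Qed.

Lemma eB_scaleDl u : {morph eB_scale^~ u : a b / a + b}.
Proof.
move=> [a1 a2] [b1 b2]; apply: val_inj; rewrite /= /cact /=.
by rewrite !scalerDl addrACA.
Qed.

HB.instance Definition _ := GRing.Zmodule_isLmodule.Build R[i] (eB j0)
  eB_scaleA eB_scale1 eB_scaleDr eB_scaleDl.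
End Complex.

(* The degree d component of e_j B e_k.  The relations are homogeneous, so
   the grading of the path algebra descends to the quotient. *)
Definition zigzag_deg (d : nat) (x : zigzag) : Prop :=
  exists2 f : A, (forall p, p \in msupp f -> qdeg p = d) & x = \pi_zigzag f.

Definition eBe (j k : 'I_n) (d : nat) (x : zigzag) : Prop :=
  (exists y, x = e_ j * y * e_ k) /\ zigzag_deg d x.

End Zigzag.

(* W is a subspace of V of dimension m: it has a basis of m vectors. *)
Definition has_dim (F : fieldType) (V : lmodType F) (W : V -> Prop) (m : nat) :=
  exists b : 'I_m -> V,
    (forall x, W x <-> exists c : 'I_m -> F, x = \sum_(i < m) c i *: b i) /\
    (forall c : 'I_m -> F, \sum_(i < m) c i *: b i = 0 -> forall i, c i = 0).

(* P is the graded dimension of e_j B e_k over F_j, where F_1 = R and F_j = C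
   for j >= 2. In particular all graded components are finite dimensional
   and almost all of them vanish. *)
Definition is_grdim (R : realType) n (j k : 'I_n) (P : {poly int}) : Prop :=
  forall d : nat, exists2 m : nat, P`_d = m%:Z &
    (j = 0%N :> nat -> has_dim (@eBe R n j k d) m) /\
    (forall j0 : (0 < j)%N,
       has_dim (fun u : eB R j0 => eBe j k d (eB_val u)) m).

Definition cartanB n : 'M[int]_n :=
  \matrix_(k < n, j < n)
    if k == j then 2
    else if (k == 1%N :> nat) && (j == 0%N :> nat) then -2
    else if (k == j.+1 :> nat) || (j == k.+1 :> nat) then -1 else 0.

(* Main.v *)
(* Upper bound: each path from j to k of degree d equals, modulo the relations,
   a real combination of G, (ie_j) G and G (ie_k), where G is the loop-free path
   e_j, (j|k) or X_j for d = 0, 1, 2, and it vanishes when there is no such G.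
   Lower bound: the functional sending a path with l loops to Re(i^l), except
   that it kills paths of degree > 2 and non-closed paths of degree 2, vanishes
   on the ideal of relations; evaluating it on x and on ie_j x (or x ie_k)
   recovers the coefficients of x. *)
From HB Require Import structures.
Require Import Defs.
From mathcomp Require Import all_boot all_order all_algebra.
From mathcomp Require Import finmap monalg complex boolp reals.
From mathcomp Require Import zify.

Set Implicit Arguments.
Unset Strict Implicit.
Unset Printing Implicit Defensive.

Import GRing.Theory.
Local Open Scope ring_scope.
Local Open Scope quotient_scope.

(** * Degrees and loop counts of walks *)

Section Walks.
Variable n : nat.
Implicit Types (x y : 'I_n) (s t : seq 'I_n).

Definition wdeg x s := count (fun a => a.1 != a.2) (zip (x :: s) s).
Definition wloops x s := count (fun a => a.1 == a.2) (zip (x :: s) s).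

Lemma wdeg_cons x y s : wdeg x (y :: s) = ((x != y) + wdeg y s)%N.
Proof. by []. Qed.

Lemma wloops_cons x y s : wloops x (y :: s) = ((x == y) + wloops y s)%N.
Proof. by []. Qed.

Lemma wdeg_cat x s t : wdeg x (s ++ t) = (wdeg x s + wdeg (last x s) t)%N.
Proof. by elim: s x => //= y s IH x; rewrite !wdeg_cons IH addnA. Qed.

Lemma wloops_cat x s t : wloops x (s ++ t) = (wloops x s + wloops (last x s) t)%N.
Proof. by elim: s x => //= y s IH x; rewrite !wloops_cons IH addnA. Qed.

Lemma wdeg0_last x s : wdeg x s = 0%N -> last x s = x.
Proof.
elim: s x => //= y s IH x; rewrite wdeg_cons.
by case: eqP => [<-|] //=; rewrite add0n; apply: IH.
Qed.

(** Vertex 1 carries no loop, so any step leaving it has degree 1. *)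
Lemma wdeg0_vertex1 x s :
  x = 0%N :> nat -> path (@qarrow n) x s -> wdeg x s = 0%N -> s = [::].
Proof.
case: s => //= y s x0 /andP[xy _]; rewrite wdeg_cons; move: xy.
by have [<-|] := eqVneq x y; rewrite // /qarrow x0 !eqn_leq ltnn !andbF.
Qed.

End Walks.

(** * The real functional on the path algebra and its vanishing on the relations *)

Section Functional.
Variables (R : realType) (n : nat).
Local Notation A := (pathalg R n).
Implicit Types (x y : 'I_n) (s t : seq 'I_n).

(** A concatenation at a common vertex is a path exactly when both pieces are, so the default value
    0 of [walk] agrees on the two sides. *)
Lemma walkM x s y t :
  walk R x s * walk R y t = if last x s == y then walk R x (s ++ t) else 0.
Proof.
have [xs|nxs] := boolP (path (@qarrow n) (x, s).1 (x, s).2); last first.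
  rewrite {1 3}/walk !insubF ?mul0r ?if_same //=.
    by rewrite cat_path (negbTE nxs).
  exact: negbTE.
have [yt|nyt] := boolP (path (@qarrow n) (y, t).1 (y, t).2); last first.
  rewrite {2 3}/walk (@insubF _ _ _ (y, t)) ?mulr0 //=; last exact: negbTE.
  have [e|//] := eqVneq (last x s) y; rewrite insubF //= cat_path e.
  by rewrite [path _ y t](negbTE nyt) andbF.
by rewrite (walk_path R xs) (walk_path R yt) -[LHS]/(pmul _ _) pmulUU.
Qed.

(* The real part of i^l. *)
Definition reI (l : nat) : R := if odd l then 0 else (-1) ^+ l./2.

Lemma reISS l : reI l.+2 = - reI l.
Proof. by rewrite /reI /= negbK; case: odd; rewrite ?oppr0 // exprS mulN1r. Qed.

(** Only the ends [x], [z], the degree [d] and the loop count [l] of a walk enter, so the two terms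
    of a relation that is a difference of paths get the same value. *)
Definition wval x z (d l : nat) : R :=
  if (2 < d)%N || (d == 2%N) && (x != z) then 0 else reI l.

Definition walk_val x s : R := wval x (last x s) (wdeg x s) (wloops x s).

Definition path_form (f : A) : R^o :=
  lin (fun p : qpath n => walk_val (qwalk p).1 (qwalk p).2 : R^o) f.
HB.instance Definition _ := GRing.Linear.copy path_form
  (lin (fun p : qpath n => walk_val (qwalk p).1 (qwalk p).2 : R^o)).

Lemma path_form_walk x s :
  path_form (walk R x s) = if path (@qarrow n) x s then walk_val x s else 0.
Proof.
case: ifP => h; first by rewrite (@walk_path R n x s h) /path_form linU.
by rewrite /walk insubF ?linear0.
Qed.

Lemma pathalg_sumE (f : A) : f = \sum_(p <- msupp f) f@_p *: vec R p.
Proof. by rewrite -[LHS]lin_id [lin]unlock. Qed.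

Lemma path_form_sandwich (p q : qpath n) y u :
  path_form (vec R p * walk R y u * vec R q) =
  if [&& qtarget p == y, last y u == qsource q & path (@qarrow n) y u]
  then wval (qsource p) (qtarget q)
         (wdeg (qwalk p).1 (qwalk p).2 + wdeg y u + wdeg (qwalk q).1 (qwalk q).2)
         (wloops (qwalk p).1 (qwalk p).2 + wloops y u
            + wloops (qwalk q).1 (qwalk q).2)
  else 0.
Proof.
case: p q => [[x s] /= hs] [[z t] /= ht]; rewrite -!walkE /qtarget /qsource /=.
rewrite walkM; have [<-|_] := eqVneq; last by rewrite mul0r linear0.
rewrite walkM last_cat; have [e|_] := eqVneq; last by rewrite linear0.
subst z.
rewrite path_form_walk !cat_path hs last_cat ht andbT /=; case: ifP => // _.
by rewrite /walk_val !last_cat !wdeg_cat !wloops_cat !last_cat.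
Qed.

(** Linearity in [a] and in [b] reduces the claim to paths on either side. *)
Lemma path_form_ext (f : A) :
  (forall p q, path_form (vec R p * f * vec R q) = 0) ->
  forall a b, path_form (a * f * b) = 0.
Proof.
move=> h a b; rewrite [a]pathalg_sumE [b]pathalg_sumE !mulr_suml linear_sum.
rewrite big1 // => p _; rewrite mulr_sumr linear_sum big1 // => q _.
rewrite -pathalg_scaleAr linearZ -pathalg_scaleAl -pathalg_scaleAl linearZ.
by rewrite /= h !scaler0.
Qed.

Lemma qarrow_adj (i j : 'I_n) : j = i.+1 :> nat ->
  (qarrow i j * qarrow j i * ((i == j) = false) * ((j == i) = false))%type.
Proof.
by move=> ji; rewrite /qarrow -!val_eqE /= ji !eqxx ?orbT !eqn_leq ltnn ?andbF.
Qed.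

Lemma qarrow_loop (j : 'I_n) : (0 < j)%N -> qarrow j j.
Proof. by move=> j0; rewrite /qarrow eqxx j0 !orbT. Qed.

(* A nonzero value in degree 2 needs a closed walk whose prefix and suffix have
   degree 0. *)
Lemma wval_2 (p q : qpath n) (l : nat) :
  qtarget p != qsource q ->
  wval (qsource p) (qtarget q)
    (wdeg (qwalk p).1 (qwalk p).2 + 2 + wdeg (qwalk q).1 (qwalk q).2) l = 0.
Proof.
move=> npq; rewrite /wval; case: ifP => // /negbT; rewrite negb_or => /andP[le2].
have dp0 : wdeg (qwalk p).1 (qwalk p).2 = 0%N by lia.
have dq0 : wdeg (qwalk q).1 (qwalk q).2 = 0%N by lia.
rewrite dp0 dq0 /= negbK => /eqP pq; case/eqP: npq.
by rewrite /qtarget wdeg0_last // -[LHS]/(qsource p) pq /qtarget wdeg0_last.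
Qed.

Lemma path_form_rel f : zigzag_rel f ->
  forall p q, path_form (vec R p * f * vec R q) = 0.
Proof.
case=> [i j k ji kj|i j k ji kj|i j k ji kj|j j0|i j i0 ji|i j i0 ji|i j i0 j1|i j i0 j1] p q;
  rewrite /arr /loop ?(mulrBr, mulrDr) ?(mulrBl, mulrDl) ?linearB ?linearD /=;
  rewrite !walkM /= ?eqxx ?walkM /= ?eqxx ?walkM /= ?eqxx ?path_form_sandwich /=;
  rewrite ?(wdeg_cons, wloops_cons) /=.
- by rewrite !(qarrow_adj ji) !(qarrow_adj kj) /= subrr.
(* The relator has degree 2 and joins the distinct vertices [i] and [k]; the down relator is treated
   alike. *)
- rewrite !(qarrow_adj ji) !(qarrow_adj kj) /=; case: ifP => // /and3P[/eqP e /eqP e' _].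
  apply: wval_2; rewrite e -e' -val_eqE /= kj ji; lia.
- rewrite !(qarrow_adj ji) !(qarrow_adj kj) /=; case: ifP => // /and3P[/eqP e /eqP e' _].
  apply: wval_2; rewrite e -e' -val_eqE /= kj ji; lia.
(* The two terms have the same ends and degree and differ by two loops, so their values are
   opposite. *)
- rewrite !qarrow_loop // eqxx /= !addn0 addn2 addSn addSn.
  case: ifP => _; rewrite ?addr0 // /wval; case: ifP; rewrite ?addr0 // reISS.
  by rewrite addNr.
- have j0 : (0 < j)%N by rewrite ji.
  by rewrite !(qarrow_adj ji) !qarrow_loop // !eqxx /= subrr.
- have j0 : (0 < j)%N by rewrite ji.
  by rewrite !(qarrow_adj ji) !qarrow_loop // !eqxx /= subrr.
(* A nonzero value forces [p] and [q] to have degree 0; both then sit at vertex 1 and are constant.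
   This leaves a single loop, and the real part of i is 0. *)
- have ji : j = i.+1 :> nat by rewrite i0.
  have j0 : (0 < j)%N by rewrite ji.
  rewrite !(qarrow_adj ji) !qarrow_loop // !eqxx /= addn0.
  case: ifP => // /and3P[/eqP e /eqP e' _].
  rewrite /wval; case: ifP => // /negbT; rewrite negb_or => /andP[le2 _].
  have dp0 : wdeg (qwalk p).1 (qwalk p).2 = 0%N by lia.
  have dq0 : wdeg (qwalk q).1 (qwalk q).2 = 0%N by lia.
  have sp0 : (qwalk p).1 = 0%N :> nat by rewrite -(wdeg0_last dp0) [last _ _]e.
  have sq0 : (qwalk q).1 = 0%N :> nat by rewrite -/(qsource q) -e'.
  rewrite (wdeg0_vertex1 sp0 (valP p) dp0) (wdeg0_vertex1 sq0 (valP q) dq0).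
  by [].
have ji : j = i.+1 :> nat by rewrite i0.
have j0 : (0 < j)%N by rewrite ji.
by rewrite !(qarrow_adj ji) !qarrow_loop // !eqxx /= subrr.
Qed.
End Functional.

Lemma scaleN_collect (K : pzRingType) (V : lmodType K) (a b c : K) (g h : V) :
  a *: h + b *: - g + c *: - g = (- b - c) *: g + a *: h.
Proof. by rewrite !scalerN scalerBl scaleNr -addrA addrC. Qed.

Lemma scale_fst (K : pzRingType) (V : lmodType K) (a : K) (x y z : V) :
  a *: x + 0 *: y + 0 *: z = a *: x.
Proof. by rewrite !scale0r !addr0. Qed.

Lemma scale_trd (K : pzRingType) (V : lmodType K) (c : K) (x y z : V) :
  0 *: x + 0 *: y + c *: z = c *: z.
Proof. by rewrite !scale0r !add0r. Qed.

(** * The functional and the products of arrows in the quotient algebra *)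

Section Generators.
Variables (R : realType) (n : nat).
Local Notation A := (pathalg R n).
Local Notation B := (zigzag R n).
Local Notation "\pi f" := (\pi_B f) (at level 9, f at level 8).

(** The elements [f] with [path_form (a * f * b) = 0] for all [a] and [b] form a two-sided ideal
    that contains the relators; then take [a = b = 1]. *)
Lemma path_form_ideal (f : A) :
  f \in ideal_of (@zigzag_rel R n) -> path_form f = 0.
Proof.
move/asboolP/(_ (fun f => forall a b, path_form (a * f * b) = 0)) => h.
rewrite -[f]mulr1 -[f]mul1r; apply: h; last by move=> g /path_form_rel; apply: path_form_ext.
split=> [a b|f1 f2 h1 h2 a b|c f1 d h1 a b].
- by rewrite mulr0 mul0r linear0.
- by rewrite mulrBr mulrBl linearB /= h1 h2 subrr.
- by rewrite (_ : a * _ * b = a * c * f1 * (d * b)) ?h1 // !mulrA.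
Qed.

Definition zform (x : B) : R^o := path_form (repr x).

Lemma zform_pi f : zform (\pi f) = path_form f.
Proof.
by apply/eqP; rewrite -subr_eq0 -linearB; apply/eqP/path_form_ideal/repr_pi.
Qed.

Lemma zform_is_linear : linear zform.
Proof.
move=> c; elim/zigzag_ind=> f; elim/zigzag_ind=> g.
by rewrite -pi_Z -pi_zD !zform_pi linearP.
Qed.
HB.instance Definition _ := GRing.isLinear.Build R B R^o _ zform zform_is_linear.

Lemma pi_rel (f : A) : zigzag_rel f -> \pi f = 0.
Proof.
move=> rf; rewrite -[RHS](raddf0 \pi_B); apply/pi_eq; rewrite subr0.
by apply/asboolP => I _; apply.
Qed.

Lemma pi_relB (f g : A) : zigzag_rel (f - g) -> \pi f = \pi g.
Proof. by move/pi_rel/eqP; rewrite raddfB subr_eq0 => /eqP. Qed.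

Definition a_ (j k : 'I_n) : B := \pi (arr R j k).

Lemma pi_walkM x s y t : \pi (walk R x s) * \pi (walk R y t) =
  if last x s == y then \pi (walk R x (s ++ t)) else 0.
Proof. by rewrite -pi_M walkM; case: ifP => // _; rewrite raddf0. Qed.

Lemma e_a j k : e_ R j * a_ j k = a_ j k.
Proof. by rewrite pi_walkM eqxx. Qed.

Lemma a_e j k : a_ j k * e_ R k = a_ j k.
Proof. by rewrite pi_walkM eqxx. Qed.

Lemma ie_e (j : 'I_n) : ie_ R j * e_ R j = ie_ R j.
Proof. by rewrite pi_walkM eqxx. Qed.

(** There is no such path, so [walk] takes its default value. This lets vertex 1 share the formulas
    of the other vertices. *)
Lemma ie_vertex1 (j : 'I_n) : j = 0%N :> nat -> ie_ R j = 0.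
Proof.
move=> j0; rewrite /ie_ /loop /walk insubF ?raddf0 //=.
by rewrite /qarrow j0 !andbF.
Qed.

Definition adj (j k : 'I_n) : bool := (k == j.+1 :> nat) || (j == k.+1 :> nat).

Lemma adjC j k : adj j k = adj k j.
Proof. exact: orbC. Qed.

Lemma adj_neq j k : adj j k -> (j == k) = false.
Proof. by rewrite /adj -val_eqE /=; lia. Qed.

Lemma ie_a (j k : 'I_n) : (0 < j)%N -> (0 < k)%N -> adj j k ->
  ie_ R j * a_ j k = a_ j k * ie_ R k.
Proof.
move=> j0 k0 /orP[]/eqP jk; rewrite -!pi_M; apply: pi_relB.
  exact: rel_loop_up.
exact: rel_loop_down.
Qed.

Lemma a_a (i j k : 'I_n) : adj i j -> adj j k -> i != k -> a_ i j * a_ j k = 0.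
Proof.
rewrite -val_eqE /= => /orP[]/eqP ij /orP[]/eqP jk ik; rewrite -pi_M.
- exact/pi_rel/rel_up.
- by move: ik; rewrite -eqSS -ij -jk eqxx.
- by move: ik; rewrite ij jk eqxx.
- exact/pi_rel/rel_down.
Qed.

(** This makes X_j independent of the neighbour through which it is written. *)
Lemma a_loop_eq (i j k : 'I_n) : adj j i -> adj j k ->
  a_ j i * a_ i j = a_ j k * a_ k j.
Proof.
have up (x y z : 'I_n) : y = x.+1 :> nat -> z = y.+1 :> nat -> a_ y x * a_ x y = a_ y z * a_ z y.
  by move=> xy yz; rewrite -!pi_M; apply: pi_relB; apply: rel_zigzag.
move=> /orP[]/eqP ij /orP[]/eqP jk.
- by have -> : i = k by apply: val_inj; rewrite /= ij jk.
- exact/esym/up.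
- exact: up.
- by have -> : i = k by apply: val_inj; apply: succn_inj; rewrite -ij -jk.
Qed.

Lemma a_ie_a (i j : 'I_n) : i = 0%N :> nat -> adj i j ->
  a_ i j * ie_ R j * a_ j i = 0.
Proof.
move=> i0; rewrite /adj i0 orbF -!pi_M => /eqP j1.
exact/pi_rel/rel_one.
Qed.

(** If [k] is vertex 1, this is the defining relation at vertex 2; otherwise the loop passes the two
    arrows in turn. *)
Lemma ie_a_a (j k : 'I_n) : (0 < j)%N -> adj j k ->
  ie_ R j * (a_ j k * a_ k j) = a_ j k * a_ k j * ie_ R j.
Proof.
move=> j0 jk; case: (posnP k) => k0.
  rewrite -!pi_M; apply: pi_relB; apply: rel_two => //.
  by move: jk; rewrite /adj k0 => /eqP.
by rewrite mulrA ie_a // -!mulrA ie_a // adjC.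
Qed.

Lemma vertex_pred (j : 'I_n) : (0 < j)%N -> exists i : 'I_n, j = i.+1 :> nat.
Proof.
by case: j => [[|j] hj] //= _; exists (Ordinal (ltnW hj)).
Qed.

Lemma ie_ieM (j : 'I_n) x : (0 < j)%N -> ie_ R j * (ie_ R j * x) = - (e_ R j * x).
Proof. by move=> j0; rewrite mulrA ie_sq // mulNr. Qed.

(* Between vertices >= 2 the zigzag relation moves a factor to the other side of
   a vertex, creating a vanishing path. Between 1 and 2, where for n = 2 there is
   no other side, one writes
   e_2 = -(ie_2)^2 and moves one factor ie_2 across X_2, which produces the
   vanishing path (1|2)(ie_2)(2|1). *)
Lemma a_a_a (j k : 'I_n) : adj j k -> a_ j k * a_ k j * a_ j k = 0.
Proof.
move=> jk; have kj : adj k j by rewrite adjC.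
case: (posnP j) => j0.
  have k0 : (0 < k)%N by move: jk; rewrite /adj j0 orbF => /eqP->.
  have h : a_ j k * ie_ R k * (a_ k j * a_ j k) = 0.
    by rewrite mulrA a_ie_a // mul0r.
  rewrite -mulrA; apply/eqP; rewrite -oppr_eq0 -[X in _ * (_ * X)]a_e.
  rewrite -(opprK (e_ R k)) -ie_sq // !mulrN opprK !mulrA.
  by rewrite -(mulrA (a_ j k)) -(mulrA (a_ j k)) -ie_a_a // mulrA h mul0r.
case: (posnP k) => k0.
  have h : a_ j k * a_ k j * (ie_ R j * a_ j k) = 0.
    by rewrite -!mulrA (mulrA (a_ k j)) a_ie_a // mulr0.
  apply/eqP; rewrite -oppr_eq0 -{1}(e_a j k) -!mulrA -ie_ieM // !mulrA.
  rewrite -(mulrA _ (a_ j k)) -(mulrA (ie_ R j) (ie_ R j)) ie_a_a //.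
  by rewrite -!mulrA in h *; rewrite h mulr0.
case/orP: (jk) => /eqP e.
  have [i ji] := vertex_pred j0; have ij : adj j i by rewrite /adj ji eqxx orbT.
  rewrite (a_loop_eq jk ij) -mulrA a_a ?mulr0 // 1?adjC // -val_eqE /=; lia.
have [i ki] := vertex_pred k0; have ik : adj k i by rewrite /adj ki eqxx orbT.
rewrite -mulrA (a_loop_eq kj ik) mulrA a_a ?mul0r // -val_eqE /=; lia.
Qed.

(** * Loop-free generators and the spanning argument *)

Variable nb : 'I_n -> 'I_n.
Hypothesis adj_nb : forall j, adj j (nb j).
Local Notation e_ := (e_ R).
Local Notation ie_ := (ie_ R).

(** The path G of degree [d], with X_j written through the chosen neighbour [nb j]. *)
Definition gen (j k : 'I_n) (d : nat) : B :=
  match d with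
  | 0 => if j == k then e_ j else 0
  | 1 => if adj j k then a_ j k else 0
  | 2 => if j == k then a_ j (nb j) * a_ (nb j) j else 0
  | _ => 0
  end.

Definition alive (j k : 'I_n) (d : nat) : bool :=
  match d with 0 | 2 => j == k | 1 => adj j k | _ => false end.

Lemma gen_dead j k d : ~~ alive j k d -> gen j k d = 0.
Proof. by case: d => [|[|[|d]]] //= /negbTE ->. Qed.

Lemma e_gen j k d : e_ j * gen j k d = gen j k d.
Proof.
case: d => [|[|[|d]]] /=; rewrite ?mulr0 //; case: ifP; rewrite ?mulr0 // ?mulrA ?e_a //.
by rewrite e_idem.
Qed.

Lemma gen_e j k d : gen j k d * e_ k = gen j k d.
Proof.
case: d => [|[|[|d]]] /=; rewrite ?mul0r //; case: ifP; rewrite ?mul0r // -?mulrA ?a_e //.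
  by move=> /eqP<-; rewrite e_idem.
by move=> /eqP<-; rewrite a_e.
Qed.

Lemma ie_gen (j k : 'I_n) d : (0 < j)%N -> (0 < k)%N ->
  ie_ j * gen j k d = gen j k d * ie_ k.
Proof.
move=> j0 k0; case: d => [|[|[|d]]] /=; rewrite ?mulr0 ?mul0r //;
  case: ifP; rewrite ?mulr0 ?mul0r //.
- by move=> /eqP<-; rewrite ie_e e_ie.
- exact: ie_a.
- by move=> /eqP<-; rewrite ie_a_a.
Qed.

(** The product is again a generator or vanishes, so [c] is 1 or 0. *)
Lemma a_gen (j y k : 'I_n) d : adj j y ->
  exists c : R, a_ j y * gen y k d = c *: gen j k d.+1.
Proof.
move=> jy; case: d => [|[|[|d]]] /=; last by exists 0; rewrite mulr0 scaler0.
- have [<-|_] := eqVneq y k; last by exists 0; rewrite mulr0 scale0r.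
  by exists 1; rewrite jy a_e scale1r.
- have [yk|_] := boolP (adj y k); last by exists 0; rewrite mulr0 scale0r.
  have [jk|njk] := eqVneq j k; last by exists 0; rewrite scale0r a_a.
  by exists 1; rewrite -jk scale1r; apply: a_loop_eq.
have [_|_] := eqVneq y k; last by exists 0; rewrite mulr0 scale0r.
(* Writing X_y through [j] turns the product into (j|y)(y|j)(j|y), which vanishes. *)
by exists 0; rewrite scale0r (a_loop_eq (adj_nb y) (k := j)) ?mulrA ?a_a_a // adjC.
Qed.

(** The inner loop is pushed out to the left if [j] is not vertex 1, and to the right if [k] is
    not. *)
Lemma a_ie_gen (j y k : 'I_n) d : adj j y ->
  exists c c' : R, a_ j y * (ie_ y * gen y k d) =
    c *: (ie_ j * gen j k d.+1) + c' *: (gen j k d.+1 * ie_ k).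
Proof.
move=> jy; have [c hc] := a_gen k d jy.
case: (posnP y) => y0.
  by exists 0, 0; rewrite ie_vertex1 // mul0r mulr0 !scale0r addr0.
case: (posnP j) => j0; last first.
  exists c, 0; rewrite scale0r addr0 mulrA -ie_a // -mulrA hc.
  by rewrite -zigzag_scaleAr.
case: (posnP k) => k0; last first.
  by exists 0, c; rewrite scale0r add0r ie_gen // mulrA hc -zigzag_scaleAl.
(* With both ends at vertex 1, only [d = 1] leaves a nonzero generator, and there the product is
   (1|2)(ie_2)(2|1) = 0. *)
exists 0, 0; rewrite !scale0r addr0.
have yk : (y == k) = false by rewrite -val_eqE /= k0 -leqn0 leqNgt y0.
have jk : j = k by apply: val_inj; rewrite /= j0 k0.
case: d {hc} => [|[|[|d]]] /=; rewrite ?yk ?mulr0 //.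
by rewrite -jk adjC jy mulrA a_ie_a.
Qed.

(** A spanning set that is uniform in the vertices: the second term vanishes if [j] is vertex 1, the
    third if [k] is, and the two terms agree up to scalars if neither is. *)
Definition gen_span (j k : 'I_n) (d : nat) (x : B) : Prop := exists a b c : R,
  x = a *: gen j k d + b *: (ie_ j * gen j k d) + c *: (gen j k d * ie_ k).

Lemma gen_span0 j k d : gen_span j k d 0.
Proof. by exists 0, 0, 0; rewrite scale_fst scale0r. Qed.

Lemma gen_spanD j k d x y :
  gen_span j k d x -> gen_span j k d y -> gen_span j k d (x + y).
Proof.
move=> [a [b [c ->]]] [a' [b' [c' ->]]]; exists (a + a'), (b + b'), (c + c').
by rewrite !scalerDl addrACA; congr (_ + _); rewrite addrACA.
Qed.

Lemma gen_spanZ j k d r x : gen_span j k d x -> gen_span j k d (r *: x).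
Proof.
move=> [a [b [c ->]]]; exists (r * a), (r * b), (r * c).
by rewrite !scalerDr !scalerA.
Qed.

Lemma gen_span_ie (j k : 'I_n) d x : (0 < j)%N ->
  gen_span j k d x -> gen_span j k d (ie_ j * x).
Proof.
move=> j0 [a [b [c ->]]]; rewrite !mulrDr -!zigzag_scaleAr ie_ieM // e_gen.
case: (posnP k) => k0.
  exists (- b), a, 0; rewrite (ie_vertex1 k0) !mulr0 scaler0 scale0r !addr0.
  by rewrite scalerN scaleNr addrC.
(* Here (ie_j) G = G (ie_k), so both loop terms return to -G. *)
exists (- b - c), a, 0; rewrite mulrA ie_gen // -mulrA ie_sq // mulrN gen_e.
by rewrite scale0r addr0 scaleN_collect.
Qed.

Lemma gen_span_a (j y k : 'I_n) d x : adj j y ->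
  gen_span y k d x -> gen_span j k d.+1 (a_ j y * x).
Proof.
move=> jy [a [b [c ->]]]; rewrite !mulrDr -!zigzag_scaleAr (mulrA _ (gen y k d)).
have [r hr] := a_gen k d jy; have [s [t ->]] := a_ie_gen k d jy.
rewrite {}hr; apply: gen_spanD; last first.
  by exists 0, 0, (c * r); rewrite scale_trd -zigzag_scaleAl scalerA.
apply: gen_spanD; first by exists (a * r), 0, 0; rewrite scale_fst scalerA.
by apply: gen_spanZ; exists 0, s, t; rewrite scale0r add0r.
Qed.

(** Induction from the left end: the first step is a loop, which keeps the degree, or an arrow to a
    neighbour, which raises it by 1. *)
Lemma gen_span_walk j s : path (@qarrow n) j s ->
  gen_span j (last j s) (wdeg j s) (\pi (walk R j s)).
Proof.
elim: s j => [|y s IH] j /=.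
  by exists 1, 0, 0; rewrite scale_fst /wdeg /= eqxx scale1r.
move=> /andP[jy ys]; have -> : \pi (walk R j (y :: s)) = a_ j y * \pi (walk R y s).
  by rewrite pi_walkM eqxx.
rewrite wdeg_cons; have [jy'|njy] := eqVneq j y.
  rewrite jy' add0n; apply: gen_span_ie (IH _ ys).
  by move: jy; rewrite jy' /qarrow eqxx !eqn_leq ltnn !andbF.
apply: gen_span_a (IH _ ys).
by move: jy; rewrite /qarrow (negbTE njy) orbF /adj orbC.
Qed.

Lemma eBe_gen_span j k d x : eBe j k d x -> gen_span j k d x.
Proof.
move=> [[y xy] [f fd xf]].
have -> : x = e_ j * x * e_ k.
  by rewrite xy !mulrA e_idem -!mulrA e_idem.
(* The representative is expanded in paths of degree [d]; the outer idempotents keep just those from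
   [j] to [k]. *)
rewrite xf [X in \pi X]pathalg_sumE raddf_sum mulr_sumr mulr_suml.
rewrite big_seq; elim/big_ind: _ => [|u v|p /fd pd]; first exact: gen_span0.
  exact: gen_spanD.
rewrite /= pi_Z -zigzag_scaleAr -zigzag_scaleAl; apply: gen_spanZ.
case: p pd => [[z s] /= zs] pd; rewrite -walkE /= pi_walkM /=.
have [jz|_] := eqVneq j z; last by rewrite mul0r; apply: gen_span0.
rewrite jz pi_walkM; have [<-|_] := eqVneq; last exact: gen_span0.
by rewrite cats0 -pd; apply: gen_span_walk.
Qed.

(** * Homogeneity of the generators *)

Lemma zigzag_deg0 d : zigzag_deg d (0 : B).
Proof. by exists 0; rewrite ?raddf0 // => p; rewrite msupp0. Qed.

Lemma zigzag_degD d (x y : B) : zigzag_deg d x -> zigzag_deg d y -> zigzag_deg d (x + y).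
Proof.
move=> [f fd ->] [g gd ->]; exists (f + g); last by rewrite pi_zD.
by move=> p /(fsubsetP (msuppD_le f g)); rewrite inE => /orP[/fd|/gd].
Qed.

Lemma zigzag_degZ d c (x : B) : zigzag_deg d x -> zigzag_deg d (c *: x).
Proof.
move=> [f fd ->]; exists (c *: f); last by rewrite pi_Z.
by move=> p /(fsubsetP (msuppZ_le c f)) /fd.
Qed.

Lemma zigzag_deg_walk j s : zigzag_deg (wdeg j s) (\pi (walk R j s)).
Proof.
have [js|njs] := boolP (path (@qarrow n) (j, s).1 (j, s).2).
  exists (walk R j s) => // p; rewrite (walk_path R js) [vec]unlock.
  by move/(fsubsetP msuppU_le); rewrite inE => /eqP ->.
by rewrite /walk insubF ?raddf0; [exact: zigzag_deg0|exact: negbTE].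
Qed.

(** An explicit loop-free walk from which the degree and the value of the functional are read
    off. *)
Lemma gen_walk (j k : 'I_n) d : alive j k d -> exists s,
  [/\ path (@qarrow n) j s, last j s = k, wdeg j s = d, wloops j s = 0%N
    & gen j k d = \pi (walk R j s)].
Proof.
have adjW x y : adj x y -> qarrow x y by rewrite /qarrow /adj orbA => /orP[]->; rewrite ?orbT.
case: d => [|[|[|d]]] //= h; rewrite h.
- by exists [::]; split => //; apply/eqP.
- by exists [:: k]; split; rewrite //= ?adjW // ?wdeg_cons ?wloops_cons (adj_neq h).
exists [:: nb j; j]; split; first by rewrite /= !adjW // adjC.
- exact/eqP.
- by rewrite !wdeg_cons (adj_neq (adj_nb j)) eq_sym (adj_neq (adj_nb j)).
- by rewrite !wloops_cons (adj_neq (adj_nb j)) eq_sym (adj_neq (adj_nb j)).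
by rewrite pi_walkM eqxx.
Qed.

Lemma ie_walk j s : ie_ j * \pi (walk R j s) = \pi (walk R j (j :: s)).
Proof. by rewrite pi_walkM eqxx. Qed.

Lemma walk_ie j s :
  \pi (walk R j s) * ie_ (last j s) = \pi (walk R j (s ++ [:: last j s])).
Proof. by rewrite pi_walkM eqxx. Qed.

Lemma gen_span_eBe j k d x : gen_span j k d x -> eBe j k d x.
Proof.
move=> [a [b [c ->]]]; split.
  (* The witness is the element itself, which [e_ j] and [e_ k] fix. *)
  exists (a *: gen j k d + b *: (ie_ j * gen j k d) + c *: (gen j k d * ie_ k)).
  have ek : ie_ k * e_ k = ie_ k by exact: ie_e.
  rewrite !mulrDr !mulrDl -!zigzag_scaleAr -!zigzag_scaleAl !mulrA e_ie !e_gen.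
  by rewrite -!mulrA ek !gen_e.
have [al|/gen_dead->] := boolP (alive j k d); last first.
  by rewrite mulr0 mul0r !scaler0 !addr0; apply: zigzag_deg0.
have [s [_ <- <- _ ->]] := gen_walk al.
apply: zigzag_degD; first apply: zigzag_degD; apply: zigzag_degZ.
- exact: zigzag_deg_walk.
- have -> : wdeg j s = wdeg j (j :: s) by rewrite wdeg_cons eqxx.
  by rewrite ie_walk; apply: zigzag_deg_walk.
have -> : wdeg j s = wdeg j (s ++ [:: last j s]).
  by rewrite wdeg_cat wdeg_cons eqxx addn0.
by rewrite walk_ie; apply: zigzag_deg_walk.
Qed.

Lemma eBeP j k d x : eBe j k d x <-> gen_span j k d x.
Proof. by split; [apply: eBe_gen_span | apply: gen_span_eBe]. Qed.

(** * Recovery of coefficients by the functional, and the graded dimensions *)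

Lemma zform_odd j s : odd (wloops j s) -> zform (\pi (walk R j s)) = 0.
Proof.
move=> o; rewrite zform_pi path_form_walk; case: ifP => // _.
by rewrite /walk_val /wval /reI o if_same.
Qed.

Lemma zform_gen j k d : alive j k d -> zform (gen j k d) = 1.
Proof.
move=> al; have [s [js sk sd sl ->]] := gen_walk al.
rewrite zform_pi path_form_walk js /walk_val sk sd sl /wval /reI /= expr0.
by move: al; case: d {sd} => [|[|[|d]]] //= ->.
Qed.

Lemma zform_ie_gen j k d : zform (ie_ j * gen j k d) = 0.
Proof.
have [al|/gen_dead->] := boolP (alive j k d); last by rewrite mulr0 linear0.
have [s [js sk sd sl ->]] := gen_walk al.
by rewrite ie_walk zform_odd // wloops_cons eqxx sl.
Qed.

Lemma zform_gen_ie j k d : zform (gen j k d * ie_ k) = 0.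
Proof.
have [al|/gen_dead->] := boolP (alive j k d); last by rewrite mul0r linear0.
have [s [js <- sd sl ->]] := gen_walk al.
by rewrite walk_ie zform_odd // wloops_cat wloops_cons eqxx sl.
Qed.

(** The 2 occurs because scalars at vertex 1 are real while G and G (ie_k) are independent over the
    reals; it gives the entry -2 of the Cartan matrix. *)
Definition grdim_coef (j k : 'I_n) (d : nat) : nat :=
  if alive j k d then (if (j == 0%N :> nat) && (0 < k)%N then 2 else 1)%N else 0%N.

Lemma has_dim_vertex1 (j k : 'I_n) d : j = 0%N :> nat ->
  has_dim (@eBe R n j k d) (grdim_coef j k d).
Proof.
move=> j0; rewrite /grdim_coef j0 /=; have iej := ie_vertex1 j0.
have [al|/gen_dead g0] := boolP (alive j k d); last first.
  exists (fun=> 0); split=> [x|c _ []] //; rewrite eBeP; split.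
    move=> [a [b [c ->]]]; exists (fun=> 0).
    by rewrite g0 mulr0 mul0r !scaler0 !addr0 big_ord0.
  by move=> [c ->]; rewrite big_ord0; apply: gen_span0.
have zg := zform_gen al; have zgi := zform_gen_ie j k d.
case: (posnP k) => k0.
  exists (fun=> gen j k d); split=> [x|c].
    rewrite eBeP; split=> [[a [b [c ->]]]|[c ->]].
      exists (fun=> a); rewrite big_ord1 iej (ie_vertex1 k0) mul0r mulr0.
      by rewrite !scaler0 !addr0.
    by exists (c ord0), 0, 0; rewrite big_ord1 !scale0r !addr0.
  rewrite big_ord1 => /(congr1 zform); rewrite linearZ linear0 /= zg => c0 i.
  by rewrite (ord1 i) -[LHS]mulr1.
exists (fun i : 'I_2 => if i == 0 then gen j k d else gen j k d * ie_ k); split=> [x|c].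
  rewrite eBeP; split=> [[a [b [c ->]]]|[c ->]].
    exists (fun i : 'I_2 => if i == 0 then a else c).
    by rewrite big_ord_recl big_ord1 /= iej mul0r scaler0 addr0.
  exists (c ord0), 0, (c (lift ord0 ord0)).
  by rewrite big_ord_recl big_ord1 /= scale0r addr0.
rewrite big_ord_recl big_ord1 /= => e0.
have c0 : c ord0 = 0.
  move/(congr1 zform): e0; rewrite linearD !linearZ linear0 /= zg zgi scaler0 addr0.
  by rewrite -[c ord0 *: _]/(c ord0 * 1) mulr1.
(* Right multiplication by [ie_ k] sends G (ie_k) to -G, whose value is -1. *)
move/(congr1 (fun x => zform (x * ie_ k))): e0.
rewrite c0 scale0r add0r -zigzag_scaleAl -mulrA ie_sq // mulrN gen_e mul0r linear0.
rewrite linearZ linearN /= zg => c1 i.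
have {}c1 : c (lift ord0 ord0) = 0.
  by apply/eqP; rewrite -oppr_eq0 -mulrN1; apply/eqP.
case: (unliftP ord0 i) => [i'|] -> //; by rewrite (ord1 i').
Qed.

Lemma has_dim_complex (j k : 'I_n) d (j0 : (0 < j)%N) :
  has_dim (fun u : eB R j0 => eBe j k d (eB_val u)) (grdim_coef j k d).
Proof.
rewrite /grdim_coef [j == _ :> nat]gtn_eqF //=.
have [al|/gen_dead g0] := boolP (alive j k d); last first.
  exists (fun=> 0); split=> [x|c _ []] //; rewrite eBeP; split.
    move=> [a [b [c xE]]]; exists (fun=> 0); apply: val_inj.
    by rewrite big_ord0 /= xE g0 mulr0 mul0r !scaler0 !addr0.
  by move=> [c ->]; rewrite big_ord0 /=; apply: gen_span0.
have gP : in_eB j (gen j k d) by apply/eqP; rewrite e_gen.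
pose g : eB R j0 := EB j0 gP.
exists (fun=> g); split=> [x|c].
  rewrite eBeP; split=> [[a [b [c xE]]]|[c ->]].
    (* The left and right loop terms coincide when [k] is not vertex 1; otherwise the right one is
       0. *)
    exists (fun=> (a +i* (if (0 < k)%N then b + c else b))%C); rewrite big_ord1; apply: val_inj.
    rewrite /= /cact /= {}xE; case: (posnP k) => k0.
      by rewrite (ie_vertex1 k0) mulr0 scaler0 addr0.
    by rewrite -(ie_gen d j0 k0) scalerDl addrA.
  exists (complex.Re (c ord0)), (complex.Im (c ord0)), 0.
  by rewrite big_ord1 /= /cact scale0r addr0.
rewrite big_ord1 => /(congr1 val) /=; rewrite /cact /=; case ce: (c ord0) => [a b] /= e0.
have zg := zform_gen al; have zig := zform_ie_gen j k d.
have a0 : a = 0.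
  move/(congr1 zform): (e0); rewrite linearD !linearZ linear0 /= zg zig scaler0 addr0.
  by rewrite -[a *: _]/(a * 1) mulr1.
have b0 : b = 0.
  (* Left multiplication by [ie_ j] exposes the imaginary part as the coefficient of -G. *)
  move/(congr1 (fun x => zform (ie_ j * x))): e0.
  rewrite a0 scale0r add0r -zigzag_scaleAr ie_ieM // e_gen mulr0 linear0.
  rewrite linearZ linearN /= zg => b0.
  by apply/eqP; rewrite -oppr_eq0 -mulrN1; apply/eqP.
by move=> i; rewrite (ord1 i) ce a0 b0.
Qed.

Definition grdim_poly (j k : 'I_n) : {poly int} :=
  \poly_(d < 3) (grdim_coef j k d)%:Z.

Lemma is_grdim_poly j k : is_grdim R j k (grdim_poly j k).
Proof.
move=> d; exists (grdim_coef j k d).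
  by rewrite coef_poly; case: d => [|[|[|d]]].
by split=> [j0|j0]; [apply: has_dim_vertex1|apply: has_dim_complex].
Qed.

End Generators.

(** * Uniqueness of dimensions and of graded dimensions *)

Lemma has_dim_leq (F : fieldType) (V : lmodType F) (W : V -> Prop) m m' :
  has_dim W m -> has_dim W m' -> (m <= m')%N.
Proof.
move=> [b [bW bfree]] [b' [b'W _]].
have bb i : exists c : 'I_m' -> F, b i = \sum_j c j *: b' j.
  apply/b'W/bW; exists (fun j => (j == i)%:R).
  rewrite (bigD1 i) //= eqxx scale1r big1 ?addr0 // => j /negbTE ->.
  by rewrite scale0r.
pose M : 'M[F]_(m, m') := \matrix_(i, j) projT1 (cid (bb i)) j.
have bM i : b i = \sum_j M i j *: b' j.
  by under eq_bigr do rewrite mxE; exact: projT2 (cid (bb i)).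
(* A vector in the left kernel of [M] is a linear relation between the [b i], hence zero; so [M] has
   rank [m]. *)
suff : row_free M by move=> /eqP <-; apply: rank_leq_col.
rewrite -kermx_eq0; apply/eqP/row_matrixP => i; rewrite row0.
have : row i (kermx M) *m M = 0 by rewrite -row_mul mulmx_ker row0.
move: (row i _) => u uM; apply/rowP => l; rewrite mxE.
apply: (bfree (fun l => u 0 l)); under eq_bigr do rewrite bM scaler_sumr.
rewrite exchange_big big1 //= => j _; under eq_bigr do rewrite scalerA.
by rewrite -scaler_suml; move/rowP/(_ j): uM; rewrite !mxE => ->; rewrite scale0r.
Qed.

Lemma is_grdim_uniq (R : realType) n (j k : 'I_n) P Q :
  is_grdim R j k P -> is_grdim R j k Q -> P = Q.
Proof.
move=> hP hQ; apply/polyP => d.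
have [m -> [mR mC]] := hP d; have [m' -> [mR' mC']] := hQ d.
congr Posz; apply/eqP; rewrite eqn_leq; case: (posnP j) => j0.
  by rewrite !(has_dim_leq (mR j0) (mR' j0), has_dim_leq (mR' j0) (mR j0)).
by rewrite !(has_dim_leq (mC j0) (mC' j0), has_dim_leq (mC' j0) (mC j0)).
Qed.

(** * Evaluation at -1 and the Cartan matrix *)

Lemma exists_neighbour n : (2 <= n)%N -> exists nb : 'I_n -> 'I_n, forall j, adj j (nb j).
Proof.
case: n => [|[|n]] // _.
(* The neighbour is the preceding vertex, except that vertex 1 takes vertex 2, which is the ordinal
   1. *)
exists (fun j => inord (if j is j'.+1 then j' else 1%N)) => -[[|j] hj].
  by rewrite /adj /= inordK.
by rewrite /adj /= inordK ?eqxx ?orbT // ltnW.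
Qed.

(** On the diagonal, degrees 0 and 2 contribute 1 each; for neighbours only degree 1 contributes,
    with sign -1. *)
Lemma grdim_poly_cartan n (k j : 'I_n) : (grdim_poly j k).[-1] = cartanB n k j.
Proof.
rewrite /grdim_poly horner_poly !big_ord_recl big_ord0 mxE /=.
rewrite expr0 expr1 (_ : (-1) ^+ _ = 1) ?mulr1 ?mulrN1 ?addr0 /bump /=; last first.
  by rewrite expr2 mulN1r opprK.
rewrite /grdim_coef /= /adj -!val_eqE /=.
do ![case: ifP => /=]; lia.
Qed.

Theorem corollary1p8p4 (R : realType) (n : nat) (hn : (2 <= n)%N) :
  (exists N : 'M[{poly int}]_n,
     forall k j : 'I_n, is_grdim R j k (N k j)) /\
  (forall N : 'M[{poly int}]_n,
     (forall k j : 'I_n, is_grdim R j k (N k j)) ->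
     map_mx (fun P : {poly int} => P.[-1]) N = cartanB n).
Proof.
have [nb adj_nb] := exists_neighbour hn.
split.
  exists (\matrix_(k, j) grdim_poly j k) => k j; rewrite mxE.
  exact: is_grdim_poly adj_nb j k.
move=> N hN; apply/matrixP => k j; rewrite mxE.
rewrite (is_grdim_uniq (hN k j) (is_grdim_poly R adj_nb j k)).
exact: grdim_poly_cartan.
Qed.
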